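(* Let $n,m$ be non-negative integers with $n+m\ge 1$. Let $J=\begin{pmatrix}J_1&J_2\\ J_3&J_4\end{pmatrix}$ be a complex matrix of order $n+m$, where $J_4$ is an $m\times m$ nonsingular matrix, and let $L=\begin{pmatrix}M&0\\0&0\end{pmatrix}$ be of order $n+m$, where $M$ is an $n\times n$ nonsingular matrix. Let $\alpha,\beta,k\in\mathbb{C}$ with $J-\alpha L$ nonsingular, $k\neq 0$ and $\beta\neq-\bar\alpha$, and put $C_{k,\alpha,\beta}=k(J+\bar\beta L)(J-\alpha L)^{-1}$. Then the eigenspace of $C_{k,\alpha,\beta}$ associated with the eigenvalues different from $k$ is the space of vectors in $\mathbb{C}^{n+m}$ whose last $m$ coordinates are zero.
   Context: For a square complex matrix $B$ and a scalar $k$, ''the eigenspace of $B$ associated with the eigenvalues different from $k$'' means the invariant (spectral) subspace of $B$ corresponding to those eigenvalues, i.e. the direct sum of the generalized eigenspaces $\ker (B-\mu I)^{N}$ ($N$ the order of $B$) over all eigenvalues $\mu\neq k$ of $B$. A bar denotes complex conjugation. *)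

(* Defs.v *)
From mathcomp Require Import all_boot all_order all_algebra.
From mathcomp Require Import reals complex.

Set Implicit Arguments.
Unset Strict Implicit.
Unset Printing Implicit Defensive.
Import Order.TTheory GRing.Theory Num.Theory.
Local Open Scope ring_scope.

Lemma geigenspace_trP (F : closedFieldType) (N : nat) (B : 'M[F]_N) (mu : F)
    (v : 'cV[F]_N) :
  reflect ((B - mu%:M) ^+ N *m v = 0) (v^T <= geigenspace B^T mu)%MS.
Proof.
case: N B v => [|N'] B v.
  rewrite [v^T]thinmx0 sub0mx; apply: ReflectT.
  by apply/matrixP => -[].
rewrite geigenspaceE.
have trX i : (B^T - mu%:M) ^+ i = ((B - mu%:M) ^+ i)^T.
  elim: i => [|i IH]; first by rewrite !expr0 trmx1.
  by rewrite exprS exprSr -!mulmxE trmx_mul IH linearB /= tr_scalar_mx.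
rewrite trX.
apply: (iffP sub_kermxP) => [|h]; last by rewrite -trmx_mul h trmx0.
by rewrite -trmx_mul => /(congr1 trmx); rewrite trmxK trmx0.
Qed.

Section Spectral.
Variables (F : closedFieldType) (N : nat).
Implicit Types (B : 'M[F]_N) (k mu : F) (v : 'cV[F]_N).

Definition eigenvalues B : seq F :=
  undup (sval (closed_field_poly_normal (char_poly B))).

Lemma mem_eigenvalues B mu : (mu \in eigenvalues B) = eigenvalue B mu.
Proof.
rewrite /eigenvalues mem_undup eigenvalue_root_char.
case: (closed_field_poly_normal _) => r /= ->.
by rewrite (monicP (char_poly_monic B)) scale1r root_prod_XsubC.
Qed.

(* MathComp's matrix subspaces are row spaces, so the transpose is what makes
   this a statement about subspaces of column vectors that B acts on from the
   left; see [geigenspace_trP]. *)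
Definition in_spectral_subspace_neq B k v : bool :=
  (v^T <= \sum_(mu <- eigenvalues B | mu != k) geigenspace B^T mu)%MS.

(* The summands above are in direct sum. *)
Lemma mxdirect_spectral_subspace_neq B k :
  mxdirect (\sum_(i < size (eigenvalues B) | (eigenvalues B)`_i != k)
              geigenspace B^T (eigenvalues B)`_i).
Proof.
apply: mxdirect_sum_geigenspace => i j _ _ /eqP.
by rewrite nth_uniq ?undup_uniq // => /eqP/val_inj.
Qed.

End Spectral.

(* The bar is [conjc], i.e. a + ib |-> a - ib. *)
Definition cayley_mx (R : realType) (N : nat) (J L : 'M[R[i]]_N)
    (k alpha beta : R[i]) : 'M[R[i]]_N :=
  k *: ((J + (beta^*)%C *: L) *m invmx (J - alpha *: L)).

(* Main.v *)
Require Import Defs.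
From mathcomp Require Import all_boot all_order all_algebra.
From mathcomp Require Import reals complex.
Set Implicit Arguments.
Unset Strict Implicit.
Unset Printing Implicit Defensive.
Import Order.TTheory GRing.Theory Num.Theory.
Local Open Scope ring_scope.

(** Write [C] for the Cayley transform, [K] for the inverse of [J - alpha L] and
    [P] for the projection of a vector to its last [m] coordinates. Since
    [(J + beta^* L) - (J - alpha L) = (beta^* + alpha) L],
    the matrix [C - k] equals [c L K] with [c = k (beta^* + alpha)] nonzero
    ([cayley_mx_sub_scalar]). The last [m] rows of [L] vanish, so [P (C - k) = 0].
    Moreover [C - k] is injective on [ker P]: if [L x = 0] for [x = K u], then
    the first block of [x] is zero because [M] is nonsingular, hence
    [P u = P J x] is [J4] times the second block of [x], and [P u = 0] forces
    [x = 0] because [J4] is nonsingular.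

    These two facts determine the spectral subspace
    ([in_spectral_subspace_neqP]). From [P (C - k) = 0], the rows of [P] are left
    eigenvectors for [k] (or zero), so they annihilate every generalized
    eigenspace of another eigenvalue. Conversely, a vector [v] of [ker P] splits
    as [u + w] with [(C - k)^N u = 0] and [w] in the spectral subspace; then
    [P u = P v - P w = 0], and [C - k], being injective on [ker P] with image in
    [ker P], gives [u = 0]. *)

Lemma char_poly_trmx (R : comNzRingType) (N : nat) (A : 'M[R]_N) :
  char_poly A^T = char_poly A.
Proof.
rewrite /char_poly -[RHS]det_tr; congr (\det _).
by rewrite /char_poly_mx linearB /= tr_scalar_mx map_trmx.
Qed.

Section SpectralSubspace.
Variables (F : closedFieldType) (N : nat).
Implicit Types (A B : 'M[F]_N) (k mu : F) (v : 'cV[F]_N).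

(** The factors [('X - mu) ^ N] are pairwise coprime, and their product is
    a multiple of the characteristic polynomial because no multiplicity exceeds
    [N]; so it annihilates [A] by Cayley-Hamilton, and the decomposition of the
    kernel of a product of coprime polynomials applies. *)
Lemma sum_geigenspace_full A (r : seq F) :
    char_poly A = \prod_(x <- r) ('X - x%:P) ->
  (1%:M <= \sum_(mu <- undup r) geigenspace A mu)%MS.
Proof.
case: N A => [|N'] A charA; first by rewrite [1%:M]thinmx0 sub0mx.
have size_r : size r = N'.+1.
  by have := size_char_poly A; rewrite charA size_prod_XsubC => -[].
rewrite (big_nth 0) big_mkord.
rewrite -kermxpoly_prod; last first.
  move=> i j _ _ neq_ji; apply/coprimep_expl/coprimep_expr.
  by rewrite coprimep_XsubC root_XsubC nth_uniq ?undup_uniq.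
set q := \prod_(i | _) _.
suff /dvdpP[p ->] : char_poly A %| q.
  by apply/sub_kermxP; rewrite mul1mx rmorphM /= Cayley_Hamilton mulr0.
rewrite charA -(prodr_undup_exp_count r xpredT (fun x => 'X - x%:P)).
rewrite (big_nth 0) big_mkord /q.
elim/big_ind2: _ => // [p1 q1 p2 q2 d1 d2|i _]; first exact: dvdp_mul.
by rewrite dvdp_exp2l // -size_r count_size.
Qed.

(** The full decomposition is applied to [B^T], whose generalized eigenspaces
    span the spectral subspace, along the eigenvalues of [B]: the two matrices
    have the same characteristic polynomial. If [k] is not an eigenvalue, then
    [u = 0]. *)
Lemma spectral_decomposition B k v :
  exists u w, [/\ v = u + w, (B - k%:M) ^+ N *m u = 0
    & in_spectral_subspace_neq B k w].
Proof.
have char_tr : char_poly B^T =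
    \prod_(x <- sval (closed_field_poly_normal (char_poly B))) ('X - x%:P).
  rewrite char_poly_trmx; case: (closed_field_poly_normal _) => r /= {1}->.
  by rewrite (monicP (char_poly_monic B)) scale1r.
have := sum_geigenspace_full char_tr; rewrite -/(eigenvalues B).
rewrite (bigID (xpred1 k)) /= => full.
have : (v^T <= geigenspace B^T k +
          \sum_(mu <- eigenvalues B | mu != k) geigenspace B^T mu)%MS.
  apply: submx_trans (submx_trans (submx1 _) full) _; apply: addsmxS => //.
  elim/big_ind: _ => [|A1 A2 s1 s2|mu /eqP->//]; first exact: sub0mx.
  by rewrite addsmx_sub s1.
case/sub_addsmxP=> -[a b] /= v_ab.
exists (a *m geigenspace B^T k)^T.
exists (b *m (\sum_(mu <- eigenvalues B | mu != k) geigenspace B^T mu)%MS)^T.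
split; first by rewrite -linearD /= -v_ab trmxK.
  by apply/geigenspace_trP; rewrite trmxK submxMl.
by rewrite /in_spectral_subspace_neq trmxK submxMl.
Qed.

(** From [P B = k P] comes [P (B - mu)^N = (k - mu)^N P]. On the generalized
    eigenspace of [mu] the left-hand side vanishes, and for [mu] other than [k]
    the scalar can be cancelled. *)
Lemma left_eigenvectors_annihilate p (P : 'M[F]_(p, N)) B k v :
  P *m (B - k%:M) = 0 -> in_spectral_subspace_neq B k v -> P *m v = 0.
Proof.
move=> PB0 v_in; apply: trmx_inj; rewrite trmx_mul trmx0; apply/sub_kermxP.
apply: submx_trans v_in _.
elim/big_ind: _ => [|A1 A2 s1 s2|mu neq_mu]; first exact: sub0mx.
  by rewrite addsmx_sub s1.
apply/rV_subP => x; rewrite -[x]trmxK => /geigenspace_trP x_mu.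
have PBmu : P *m (B - mu%:M) = (k - mu) *: P.
  rewrite -[B](subrK k%:M) -addrA mulmxDr PB0 add0r -raddfB /=.
  by rewrite mul_mx_scalar.
have PBmuX i : P *m (B - mu%:M) ^+ i = (k - mu) ^+ i *: P.
  elim: i => [|i IH]; first by rewrite !expr0 mulmx1 scale1r.
  by rewrite exprSr -mulmxE mulmxA IH -scalemxAl PBmu scalerA exprSr.
apply/sub_kermxP; rewrite -trmx_mul -[RHS]trmx0; congr trmx.
have := congr1 (mulmx^~ x^T) (PBmuX N) => /esym/eqP.
rewrite /= -mulmxA x_mu mulmx0 -scalemxAl scaler_eq0 expf_eq0 subr_eq0 eq_sym.
by rewrite (negPf neq_mu) andbF /= => /eqP.
Qed.

(** A criterion that avoids computing the spectral subspace: [ker P] contains the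
    image of [B - k], so [B - k] acts on it, and injectivity there leaves no room
    in [ker P] for generalized eigenvectors for [k]. *)
Lemma in_spectral_subspace_neqP p (P : 'M[F]_(p, N)) B k v :
    P *m (B - k%:M) = 0 ->
    (forall u : 'cV_N, P *m u = 0 -> (B - k%:M) *m u = 0 -> u = 0) ->
  in_spectral_subspace_neq B k v <-> P *m v = 0.
Proof.
move=> PE0 Einj; split; first exact: left_eigenvectors_annihilate.
have [u [w [-> Eu0 w_in]]] := spectral_decomposition B k v.
rewrite mulmxDr (left_eigenvectors_annihilate PE0 w_in) addr0 => Pu0.
suff -> : u = 0 by rewrite add0r.
elim: (N in _ ^+ N) Eu0 => [|i IH]; first by rewrite expr0 mul1mx.
rewrite exprS -mulmxE -mulmxA => Eu0; apply/IH/Einj => //.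
(* [P] annihilates [(B - k)^i u]: for [i = 0] this is [P u = 0], and otherwise
     it comes from [P (B - k) = 0]. *)
case: i {IH Eu0} => [|i]; first by rewrite expr0 mul1mx.
by rewrite exprS -mulmxE !mulmxA PE0 !mul0mx.
Qed.

End SpectralSubspace.

Lemma cayley_mx_sub_scalar (R : realType) (N : nat) (J L : 'M[R[i]]_N)
    (k alpha beta : R[i]) : J - alpha *: L \in unitmx ->
  cayley_mx J L k alpha beta - k%:M
    = (k * ((beta^*)%C + alpha)) *: (L *m invmx (J - alpha *: L)).
Proof.
move=> JL_unit; rewrite /cayley_mx -scalemx1 -(mulmxV JL_unit) -scalerBr.
rewrite -mulmxBl opprB addrA addrAC [J + _ - J]addrAC subrr add0r -scalerDl.
by rewrite -scalemxAl scalerA.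
Qed.

Theorem corollary2p5 (R : realType) (n m : nat)
    (J1 : 'M[R[i]]_(n, n)) (J2 : 'M[R[i]]_(n, m))
    (J3 : 'M[R[i]]_(m, n)) (J4 : 'M[R[i]]_(m, m)) (M : 'M[R[i]]_(n, n))
    (alpha beta k : R[i]) (J L : 'M[R[i]]_(n + m))
    (nm_ge1 : (1 <= n + m)%N)
    (J_def : J = block_mx J1 J2 J3 J4)
    (J4_unit : J4 \in unitmx)
    (L_def : L = block_mx M 0 0 0)
    (M_unit : M \in unitmx)
    (JL_unit : J - alpha *: L \in unitmx)
    (k_neq0 : k != 0)
    (beta_neq : beta != - (alpha^*)%C) :
  forall v : 'cV[R[i]]_(n + m),
    in_spectral_subspace_neq (cayley_mx J L k alpha beta) k v <->
    (forall j : 'I_m, v (rshift n j) 0 = 0).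
Proof.
move=> v.
have c_neq0 : k * ((beta^*)%C + alpha) != 0.
  rewrite mulf_neq0 // addr_eq0; apply: contraNneq beta_neq => beta_conj.
  by rewrite -[beta]conjcK beta_conj rmorphN.
pose P : 'M[R[i]]_(m, n + m) := row_mx 0 1%:M.
have PE (u : 'cV_(n + m)) : P *m u = dsubmx u.
  by rewrite -{1}[u]vsubmxK mul_row_col mul0mx add0r mul1mx.
apply: (@iff_trans _ (P *m v = 0)); last first.
  rewrite PE; split=> [/colP v0 j|v0]; first by have := v0 j; rewrite !mxE.
  by apply/colP=> j; rewrite !mxE v0.
apply: in_spectral_subspace_neqP; rewrite cayley_mx_sub_scalar //.
  rewrite -scalemxAr mulmxA L_def mul_row_block.
  by rewrite !(mul0mx, mulmx0, addr0) row_mx0 mul0mx scaler0.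
move=> u Pu0 /eqP; rewrite -scalemxAl scaler_eq0 (negPf c_neq0) /= => /eqP.
set K := invmx _; rewrite -mulmxA => Lx0.
have uE : u = J *m (K *m u).
  rewrite -{1}[u](mulKVmx JL_unit) -/K mulmxBl -scalemxAl Lx0 scaler0.
  by rewrite subr0.
move: Lx0 uE; set x := K *m u; rewrite -[x]vsubmxK => Lx0 uE.
have x1_0 : usubmx x = 0.
  move: Lx0; rewrite L_def mul_block_col !mul0mx !addr0 -col_mx0.
  by case/eq_col_mx => Mx1 _; rewrite -(mulKmx M_unit (usubmx x)) Mx1 mulmx0.
have x2_0 : dsubmx x = 0.
  move: Pu0; rewrite PE uE J_def mul_block_col col_mxKd x1_0 mulmx0 add0r.
  by move=> Jx2; rewrite -(mulKmx J4_unit (dsubmx x)) Jx2 mulmx0.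
by rewrite uE x1_0 x2_0 col_mx0 mulmx0.
Qed.
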